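(* Let $a,b$ be positive integers. If $G$ is an $a$-path-pairable graph with $|V(G)|\geq 8a$ and $H$ is a $b$-path-pairable graph with $|V(H)|\geq 8b$, then the Cartesian product $G\square H$ is $(a+b)$-path-pairable.
   Context: Graphs are finite, simple and undirected. For a positive integer $k$, a graph $G$ on at least $2k$ vertices is called $k$-path-pairable if, for any pair of disjoint sets of pairwise different vertices $X=\{x_1,\dots,x_k\}$ and $Y=\{y_1,\dots,y_k\}$ of $G$ (so $x_1,\dots,x_k,y_1,\dots,y_k$ are $2k$ distinct vertices), there exist $k$ pairwise edge-disjoint paths $P_1,\dots,P_k$ in $G$ such that $P_i$ joins $x_i$ to $y_i$. The Cartesian product $G\square H$ has vertex set $V(G)\times V(H)$, and $(x,u)(y,v)$ is an edge if $x=y$ and $uv\in E(H)$, or $xy\in E(G)$ and $u=v$. *)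

(* Defs.v *)
From mathcomp Require Import all_boot.

Set Implicit Arguments.
Unset Strict Implicit.
Unset Printing Implicit Defensive.

Record sgraph := SGraph {
  vertex :> finType;
  adj : rel vertex;
  adj_sym : symmetric adj;
  adj_irrefl : irreflexive adj }.

Definition is_path (G : sgraph) (x y : G) (p : seq G) : bool :=
  [&& path (@adj G) x p, last x p == y & uniq (x :: p)].

(* An edge is the unordered pair [set u; v], so edge-disjointness of paths
   does not depend on the direction in which an edge is traversed. *)
Definition path_edges (G : sgraph) (x : G) (p : seq G) : {set {set G}} :=
  [set [set e.1; e.2] | e in zip (x :: p) p].

Definition path_pairable (k : nat) (G : sgraph) : Prop :=
  2 * k <= #|G| /\
  forall x y : 'I_k -> G,
    injective x -> injective y -> (forall i j, x i != y j) ->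
    exists P : 'I_k -> seq G,
      (forall i, is_path (x i) (y i) (P i)) /\
      (forall i j, i != j ->
         [disjoint path_edges (x i) (P i) & path_edges (x j) (P j)]).

Section CartesianProduct.
Variables G H : sgraph.

Definition cart_adj : rel (G * H) := fun p q =>
  (p.1 == q.1) && adj p.2 q.2 || adj p.1 q.1 && (p.2 == q.2).

Lemma cart_adj_sym : symmetric cart_adj.
Proof.
by move=> p q; rewrite /cart_adj [p.1 == _]eq_sym [p.2 == _]eq_sym
  [adj p.1 _]adj_sym [adj p.2 _]adj_sym.
Qed.

Lemma cart_adj_irrefl : irreflexive cart_adj.
Proof. by move=> p; rewrite /cart_adj !adj_irrefl andbF. Qed.

Definition cart_prod : sgraph := SGraph cart_adj_sym cart_adj_irrefl.

End CartesianProduct.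

(* Main.v *)
Require Import Defs.
From mathcomp Require Import all_boot zify.

Set Implicit Arguments.
Unset Strict Implicit.
Unset Printing Implicit Defensive.

(** View the product as a grid in which every vertex v of H gives a row, a copy
of G, and every vertex u of G gives a column, a copy of H. By symmetry let
a <= b. Rows and columns are pairwise edge-disjoint, a row can link any a
disjoint pairs of its vertices, and a column any b.

Suppose first that every column holds at most b terminals. There are 2(a + b)
terminals, hence at least 8b - 2(a + b) >= a + b rows without any, so each pair
can own one such row, its free row ([injection_avoiding]). Inside its column each terminal travels to the free row
of its pair, and the pair is joined along that row; a pair whose two terminals
share a column is linked inside that column instead. Each column links at most
as many pairs as it has terminals.

In general the terminals are first shifted along their own rows until no column
holds more than b of them ([levelling_exists]). This is greedy: as long as some
column is too full, one of its terminals is shifted along its row to a vacant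
cell of a column holding fewer than b, without ever making more than a
shifts in one row. The shifts in a row then link at most a disjoint pairs of
vertices, which pairability of G provides. That the greedy step is never stuck
([levelling_step]) is a matter of counting, since there are at most 4b
terminals and at least 5 columns; the delicate point is that a too full column
never has two terminals in rows that are used up ([exhausted_row_uniq]).

Edge-disjoint paths are handled as colourings of the edges: pair i gets colour
i, and its ends must be connected by edges of that colour. Disjointness is then
automatic, pieces of a route are glued by transitivity of connectedness, and
the colourings of rows and columns combine into one of the product
([cart_colour]). *)

(** * Edge colourings in place of families of paths *)

Section Colouring.
Variables (G : sgraph) (I : finType).

Definition colour_rel (c : G -> G -> option I) (i : I) : rel G :=
  fun u v => adj u v && (c u v == Some i).

(** Pairs with index in [D] are joined by pairwise edge-disjoint walks: the
colour of an edge names the pair, if any, allowed to use it. Symmetry of [c]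
makes it a colouring of undirected edges. *)
Definition linked (D : {set I}) (x y : I -> G) :=
  exists2 c : G -> G -> option I, (forall u v, c u v = c v u) &
    {in D, forall i, connect (colour_rel c i) (x i) (y i)}.

Lemma colour_rel_sym c i :
  (forall u v, c u v = c v u) -> connect_sym (colour_rel c i).
Proof.
by move=> cC; apply: sym_connect_sym => u v; rewrite /colour_rel adj_sym cC.
Qed.

Lemma path_edges_cons (x y : G) p :
  path_edges x (y :: p) = [set x; y] |: path_edges y p.
Proof.
apply/setP=> e; rewrite !inE; apply/imsetP/orP => [[d]|].
  rewrite /= inE => /predU1P[-> ->|pd ->]; first by left; rewrite eqxx.
  by right; apply/imsetP; exists d.
case=> [/eqP->|/imsetP[d pd ->]]; first by exists (x, y); rewrite //= mem_head.
by exists d; rewrite //= inE pd orbT.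
Qed.

Lemma path_in_edges (E : {set {set G}}) (x : G) p :
  path (@adj G) x p -> path_edges x p \subset E ->
  path (fun u v => adj u v && ([set u; v] \in E)) x p.
Proof.
elim: p x => //= y p IHp x /andP[xy yp].
by rewrite path_edges_cons subUset sub1set xy => /andP[-> /(IHp _ yp)].
Qed.

Lemma path_edges_colour c i (x : G) p e :
  path (colour_rel c i) x p -> e \in path_edges x p ->
  exists u v, e = [set u; v] /\ c u v = Some i.
Proof.
elim: p x => [x _ /imsetP[d]|y p IHp x /=]; first by rewrite in_nil.
case/andP=> /andP[_ /eqP cxy] yp; rewrite path_edges_cons 2!inE.
by case/orP=> [/eqP->|/(IHp _ yp)//]; exists x, y.
Qed.

Lemma set2_eq (u v u' v' : G) : [set u; v] = [set u'; v'] ->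
  u = u' /\ v = v' \/ u = v' /\ v = u'.
Proof.
move=> E; have := set21 u' v'; have := set22 u' v'; rewrite -E.
have := set21 u v; have := set22 u v; rewrite {1 2}E !in_set2.
by do 4![case/pred2P=> ?]; subst; auto.
Qed.

(** An edge is coloured by the path through it, which is unique by
disjointness. *)
Lemma paths_linked (D : {set I}) (x y : I -> G) (P : I -> seq G) :
  {in D, forall i, is_path (x i) (y i) (P i)} ->
  {in D &, forall i j, i != j ->
     [disjoint path_edges (x i) (P i) & path_edges (x j) (P j)]} ->
  linked D x y.
Proof.
move=> Ppath Pdis.
exists (fun u v => [pick i in D | [set u; v] \in path_edges (x i) (P i)]).
  by move=> u v; rewrite setUC.
move=> i Di; have /and3P[adjP /eqP <- _] := Ppath i Di.
apply/connectP; exists (P i) => //.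
apply: sub_path (path_in_edges adjP (subxx _)) => u v /andP[uv Euv].
rewrite /colour_rel uv /=; case: pickP => [j /andP[Dj Ej]|/(_ i)]; last first.
  by rewrite Di Euv.
have [->//|ij] := eqVneq i j.
by have /pred0P/(_ [set u; v]) := Pdis i j Di Dj ij; rewrite /= Euv Ej.
Qed.

(** Shortening a walk inside one colour class gives a simple path, and the
classes share no edge. *)
Lemma linked_paths (x y : I -> G) : linked setT x y ->
  exists P : I -> seq G,
    (forall i, is_path (x i) (y i) (P i)) /\
    (forall i j, i != j ->
       [disjoint path_edges (x i) (P i) & path_edges (x j) (P j)]).
Proof.
case=> c cC con.
have simple i : exists p, path (colour_rel c i) (x i) p /\
    is_path (x i) (y i) p.
  have /connectP[p xp ->] := con i (in_setT i).
  case/shortenP: xp => q xq uq _; exists q; split=> //.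
  rewrite /is_path eqxx uq !andbT.
  by apply: sub_path xq => u v /andP[].
have [P PP] := fin_all_exists simple; exists P; split=> [i|i j].
  by have [] := PP i.
apply: contraNT => /pred0Pn[e /andP[/= ei ej]].
have [u [v [euv cuv]]] := path_edges_colour (PP i).1 ei.
have [u' [v' [euv' cuv']]] := path_edges_colour (PP j).1 ej.
case: (set2_eq (etrans (esym euv) euv')) cuv => [[-> ->]|[-> ->]];
  last rewrite cC.
  by rewrite cuv' => -[->].
by rewrite cuv' => -[->].
Qed.

End Colouring.

(** * Linking fewer pairs than the graph allows *)

(** Pairability for exactly [k] pairs also links any smaller family: a graph
with at least [2 * k] vertices has room to complete the family with
[k - #|D|] dummy pairs of unused vertices. *)
Lemma path_pairable_linked k (G : sgraph) (I : finType) (D : {set I})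
    (x y : I -> G) :
  path_pairable k G -> #|D| <= k ->
  {in D &, injective x} -> {in D &, injective y} ->
  {in D &, forall i j, x i != y j} -> linked D x y.
Proof.
move=> [Gk link] Dk injx injy xy.
have [->|[i0 Di0]] := set_0Vmem D.
  by exists (fun _ _ => None) => // i; rewrite inE.
(* [r] lists the unused vertices; its first [d] entries serve as the dummy
   sources and its next [d] entries as the dummy targets. *)
pose d := k - #|D|; pose W := x @: D :|: y @: D; pose r := enum (~: W).
pose sx := map x (enum D) ++ take d r.
pose sy := map y (enum D) ++ take d (drop d r).
have r_size : 2 * d <= size r.
  rewrite -cardE cardsCs setCK.
  have [+ _] := leq_card_setU (x @: D) (y @: D); rewrite -/W.
  have := leq_imset_card x D; have := leq_imset_card y D.
  have := max_card (mem W).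
  rewrite /d; move: Gk Dk; move: #|W| #|G| #|D| #|_ @: D| #|_ @: D|; lia.
have sx_size : size sx = k.
  rewrite size_cat size_map -cardE size_takel; [rewrite /d|]; lia.
have sy_size : size sy = k.
  rewrite size_cat size_map -cardE size_takel ?size_drop; [rewrite /d|]; lia.
have uniq_map (f : I -> G) : {in D &, injective f} -> uniq (map f (enum D)).
  move=> injf; rewrite map_inj_in_uniq ?enum_uniq // => i j.
  by rewrite !mem_enum; apply: injf.
have r_notin (f : I -> G) (s : seq G) : f @: D \subset W -> {subset s <= r} ->
    ~~ has (mem (map f (enum D))) s.
  move=> fW sr; apply/hasPn => v /sr; rewrite mem_enum inE; apply: contra.
  by case/mapP=> i; rewrite mem_enum => Di ->; apply/(subsetP fW)/imset_f.
have xW : x @: D \subset W by apply: subsetUl.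
have yW : y @: D \subset W by apply: subsetUr.
have r1 : {subset take d r <= r} by move=> v /mem_take.
have r2 : {subset take d (drop d r) <= r} by move=> v /mem_take/mem_drop.
have ur : uniq r by apply: enum_uniq.
have u_sx : uniq sx by rewrite cat_uniq uniq_map // r_notin // take_uniq.
have u_sy : uniq sy.
  by rewrite cat_uniq uniq_map // r_notin // take_uniq // drop_uniq.
have sxy v : v \in sx -> v \in sy -> False.
  rewrite !mem_cat => /orP[vx|v1] /orP[vy|v2].
  - case/mapP: vx vy => i; rewrite mem_enum => Di -> /mapP[j].
    by rewrite mem_enum => Dj /eqP; apply/negP/xy.
  - by have /hasPn/(_ v v2) := r_notin x _ xW r2; rewrite /= vx.
  - by have /hasPn/(_ v v1) := r_notin y _ yW r1; rewrite /= vy.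
  - move: ur; rewrite -(cat_take_drop d r) cat_uniq => /and3P[_ /hasPn dis _].
    by have := dis v (mem_take v2); rewrite /= v1.
pose x' (i : 'I_k) := nth (x i0) sx i; pose y' (i : 'I_k) := nth (x i0) sy i.
have [||i j|P [Ppath Pdis]] := link x' y'.
- by move=> i j /eqP; rewrite nth_uniq ?sx_size // => /eqP/val_inj.
- by move=> i j /eqP; rewrite nth_uniq ?sy_size // => /eqP/val_inj.
- apply/eqP=> E; apply: (@sxy (x' i)); first by rewrite mem_nth ?sx_size.
  by rewrite E mem_nth ?sy_size.
have idx i : i \in D -> index i (enum D) < #|D|.
  by move=> Di; rewrite cardE index_mem mem_enum.
have k_gt0 : 0 < k by apply: leq_trans Dk; apply/card_gt0P; exists i0.
pose h i : 'I_k := insubd (Ordinal k_gt0) (index i (enum D)).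
have hE i : i \in D -> h i = index i (enum D) :> nat.
  by move=> Di; rewrite val_insubd (leq_trans (idx i Di) Dk).
have nth_h (f : I -> G) s i : i \in D ->
    nth (x i0) (map f (enum D) ++ s) (h i) = f i.
  move=> Di; rewrite hE // nth_cat size_map -cardE idx //.
  by rewrite (nth_map i0) -?cardE ?idx // nth_index ?mem_enum.
have x'h i : i \in D -> x' (h i) = x i by move=> Di; apply: nth_h.
have y'h i : i \in D -> y' (h i) = y i by move=> Di; apply: nth_h.
apply: (@paths_linked _ _ _ _ _ (P \o h)) => [i Di|i j Di Dj ij] /=.
  by rewrite -x'h // -y'h.
rewrite -x'h // -[x j]x'h //; apply: Pdis; apply: contra_neq ij => hij.
have := hE _ Di; rewrite hij hE // => /(congr1 (nth i0 (enum D))).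
by rewrite !nth_index ?mem_enum.
Qed.

Lemma path_pairable_connected k (G : sgraph) (u v : G) :
  0 < k -> path_pairable k G -> connect (@adj G) u v.
Proof.
move=> k_gt0 Gk; have [->|uv] := eqVneq u v; first exact: connect0.
have [||||c _ con] :=
  @path_pairable_linked k G unit setT (fun=> u) (fun=> v) Gk.
- by rewrite cardsT card_unit.
- by case=> [] [].
- by case=> [] [].
- by [].
have := con tt (in_setT _); apply: connect_sub => w z /andP[wz _].
exact: connect1.
Qed.

Lemma path_pairable_iso k (G H : sgraph) (f : G -> H) (g : H -> G) :
  cancel f g -> cancel g f -> (forall u v, adj (f u) (f v) = adj u v) ->
  path_pairable k H -> path_pairable k G.
Proof.
move=> fK gK f_adj Hk; have [H_card _] := Hk; split.
  by rewrite (bij_eq_card (Bijective fK gK)).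
move=> x y injx injy xy; apply: linked_paths.
have [||||c cC con] :=
  @path_pairable_linked k H _ setT (f \o x) (f \o y) Hk.
- by rewrite cardsT card_ord.
- by move=> i j _ _ /(can_inj fK)/injx.
- by move=> i j _ _ /(can_inj fK)/injy.
- by move=> i j _ _; rewrite (inj_eq (can_inj fK)).
exists (fun u v => c (f u) (f v)) => // i Di.
have /connectP[p xp yp] := con i Di; apply/connectP; exists (map g p).
  rewrite -[x i]fK path_map; apply: sub_path xp => u v.
  by rewrite /colour_rel /= -f_adj !gK.
by rewrite -[x i]fK last_map -yp /= fK.
Qed.

(** * Levelling the columns *)

(** Each [t : T] is a terminal, placed in the cell ([col t], [row t]) of a grid
with columns [C] and rows [R]. A map [s : T -> C] describes new positions of
the terminals, each inside its own row. *)
Section Levelling.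
Variables (T C R : finType) (col : T -> C) (row : T -> R) (a b : nat).
Hypothesis cell_inj : forall s t, col s = col t -> row s = row t -> s = t.
Hypothesis a_gt0 : 0 < a.

Definition load (s : T -> C) u := #|[set t | s t == u]|.
Definition moved (s : T -> C) := [set t | s t != col t].
Definition row_moves (s : T -> C) v := #|moved s :&: [set t | row t == v]|.

Definition crowded := [set u | b < load col u].

(** The invariant of the greedy process. Terminals leave only columns that were
crowded at the start and enter only columns that were not. Hence no terminal
moves twice, and in a row no column is both left and entered, which is what
makes the moves in that row a family of disjoint pairs. Crowded columns never
drop below [b], so that they cannot become destinations. *)
Record levelling (s : T -> C) : Prop := Levelling {
  lev_inj : forall t t', s t = s t' -> row t = row t' -> t = t';
  lev_moved : forall t, t \in moved s -> col t \in crowded /\ s t \notin crowded;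
  lev_crowded : forall u, u \in crowded -> b <= load s u;
  lev_sparse : forall u, u \notin crowded -> load s u <= b;
  lev_row : forall v, row_moves s v <= a }.

Lemma levelling_init : levelling col.
Proof.
have no_moved : moved col = set0 by apply/setP=> t; rewrite !inE eqxx.
split=> [|t|u|u|v]; rewrite ?no_moved ?inE //.
- exact: ltnW.
- by rewrite -leqNgt.
- by rewrite /row_moves no_moved set0I cards0.
Qed.

(** Two terminals of an overfull column [u] lying in used-up rows would witness
[2 * a] moves, all from crowded columns other than [u]. The moved terminals sit
in columns that are not crowded, more than [b] others are now in [u], and at
least [b] others in one of the columns that were left: more than
[2 * (a + b)] terminals in all. *)
Lemma exhausted_row_uniq s u t t' :
  #|T| <= 2 * (a + b) -> levelling s -> b < load s u ->
  s t = u -> s t' = u ->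
  a <= row_moves s (row t) -> a <= row_moves s (row t') ->
  t = t'.
Proof.
move=> T_card lev u_over st st' mt mt'; apply/eqP; apply: contraT => tt'.
have rtt' : row t != row t'.
  by apply: contra tt' => /eqP/(lev_inj lev)->//; rewrite st st'.
have u_crowded : u \in crowded.
  by apply: contraLR u_over => /(lev_sparse lev); rewrite -leqNgt.
have still x : s x = u -> col x = u.
  move=> sx; have [/(lev_moved lev)[_]|] := boolP (x \in moved s).
    by rewrite sx u_crowded.
  by rewrite inE negbK sx => /eqP.
pose M v := moved s :&: [set x | row x == v].
have M_card : 2 * a <= #|M (row t) :|: M (row t')|.
  rewrite cardsU (_ : M _ :&: M _ = set0).
    by rewrite cards0 subn0 mul2n -addnn leq_add.
  apply/setP=> x; rewrite !inE; apply/negbTE.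
  by apply: contra rtt' => /andP[/andP[_ /eqP->] /andP[_ /eqP->]].
have M_col x z : x \in M (row z) -> s z = u -> col x != u.
  rewrite in_setI in_set => /andP[mx /eqP rx] sz; apply/eqP=> cx.
  have xz : x = z by apply: cell_inj; rewrite // cx still.
  by move: mx; rewrite xz inE sz still ?eqxx.
(* Any moved terminal [x] in one of these rows exhibits the second crowded
   column. *)
have /card_gt0P[x xM] : 0 < #|M (row t)| by apply: leq_trans mt.
have [x_crowded _] : col x \in crowded /\ s x \notin crowded.
  by apply: (lev_moved lev); move: xM; rewrite in_setI => /andP[].
have xu := M_col x t xM st.
pose A := [set z | s z == u]; pose B := [set z | s z == col x].
pose E := M (row t) :|: M (row t').
have AB : A :&: B = set0.
  apply/setP=> z; rewrite !inE; apply/negbTE; apply: contra xu.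
  by case/andP=> /eqP-> /eqP->.
have ABE : (A :|: B) :&: E = set0.
  apply/setP=> z; rewrite [RHS]inE; apply/negbTE/negP.
  rewrite in_setI => /andP[zAB zE].
  have /(lev_moved lev)[_] : z \in moved s.
    by move: zE; rewrite in_setU !in_setI => /orP[]/andP[].
  by move: zAB; rewrite !in_setU ![z \in [set _ | _]]inE => /orP[]/eqP->;
     rewrite ?u_crowded ?x_crowded.
have := max_card (mem ((A :|: B) :|: E)).
rewrite cardsU ABE cards0 cardsU AB cards0.
have A_card : b < #|A| := u_over.
have B_card : b <= #|B| := lev_crowded lev x_crowded.
move: M_card; rewrite -/E; lia.
Qed.

(** Some column [w] has fewer than [b] terminals, by counting. At least [b] of
the terminals in [u] lie in rows that still allow a move, by
[exhausted_row_uniq]. These rows are distinct, so the terminals in [w] cannot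
block all of them. *)
Lemma levelling_step s u :
  #|T| <= 2 * (a + b) -> #|T| < #|C| * b -> levelling s -> b < load s u ->
  exists2 s', levelling s' & #|moved s| < #|moved s'|.
Proof.
move=> T_card C_card lev u_over.
have u_crowded : u \in crowded.
  by apply: contraLR u_over => /(lev_sparse lev); rewrite -leqNgt.
have [w w_free] : exists w, load s w < b.
  apply/existsP; apply: contraLR C_card; rewrite negb_exists -leqNgt.
  move/forallP=> full.
  rewrite -sum_nat_const -sum1_card (partition_big s predT) //=.
  apply: leq_sum => v _; have := full v; rewrite -leqNgt => /leq_trans-> //.
  by rewrite /load -sum1_card; under eq_bigl do rewrite inE.
have w_sparse : w \notin crowded.
  by apply: contraL w_free => /(lev_crowded lev); rewrite -leqNgt.
have wu : w != u by apply: contraNneq w_sparse => ->.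
pose avail := [set t | (s t == u) && (row_moves s (row t) < a)].
have avail_card : b <= #|avail|.
  pose bad := [set t | s t == u] :\: avail.
  have bad_card : #|bad| <= 1.
    apply/card_le1_eqP=> t t'; rewrite !inE.
    case/andP=> + /eqP st /andP[+ /eqP st']; rewrite st st' eqxx /= -!leqNgt.
    move=> mt mt'; apply/esym; move: mt mt'.
    exact: (exhausted_row_uniq T_card lev u_over st st').
  have sub : avail \subset [set t | s t == u].
    by apply/subsetP=> t; rewrite !inE => /andP[].
  move: bad_card u_over; rewrite /bad /load cardsD (setIidPr sub); lia.
have [t [t_u t_row t_free]] : exists t, [/\ s t = u, row_moves s (row t) < a &
    forall t', s t' = w -> row t' <> row t].
  case: (pickP [pred t in avail |
      [forall t', (s t' == w) ==> (row t' != row t)]]) => [t /= | none].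
    rewrite inE => /andP[/andP[/eqP t_u t_row] /forallP t_free].
    exists t; split=> // t' st'; apply/eqP.
    by have /implyP-> := t_free t'; rewrite ?st'.
  (* Otherwise every row of [avail] contains a terminal now in [w]. *)
  suff : #|avail| <= load s w by lia.
  have row_inj : {in avail &, injective row}.
    move=> t t'; rewrite !inE => /andP[/eqP st _] /andP[/eqP st' _].
    by apply: (lev_inj lev); rewrite st st'.
  rewrite -(card_in_imset row_inj).
  apply: leq_trans (leq_imset_card row _); apply/subset_leq_card/subsetP=> v.
  case/imsetP=> t t_av ->; have := none t; rewrite /= t_av /=.
  move/negbT; rewrite negb_forall => /existsP[t'].
  rewrite negb_imply negbK => /andP[st' /eqP<-]; apply/imset_f.
  by rewrite inE.
have t_col : col t = u.
  have [/(lev_moved lev)[_]|] := boolP (t \in moved s).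
    by rewrite t_u u_crowded.
  by rewrite inE negbK t_u => /eqP.
pose s' z := if z == t then w else s z.
have s't : s' t = w by rewrite /s' eqxx.
have s'N z : z != t -> s' z = s z by move=> zt; rewrite /s' (negbTE zt).
have t_still : t \notin moved s by rewrite inE t_u t_col eqxx.
have moved_s' : moved s' = t |: moved s.
  apply/setP=> z; rewrite !inE /s'; case: (eqVneq z t) => //= ->.
  by rewrite t_col.
exists s'; last by rewrite moved_s' cardsU1 t_still.
have load_w : load s' w = (load s w).+1.
  rewrite /load (cardsD1 t) inE s't eqxx; congr _.+1; apply: eq_card => z.
  rewrite !inE /s'; case: (eqVneq z t) => //= ->; rewrite t_u.
  by rewrite eq_sym (negbTE wu).
have load_u : load s u = (load s' u).+1.
  rewrite /load (cardsD1 t) inE t_u eqxx; congr _.+1; apply: eq_card => z.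
  by rewrite !inE /s'; case: (eqVneq z t) => //= _; rewrite (negbTE wu).
have load_v v : v != w -> v != u -> load s' v = load s v.
  move=> vw vu; apply: eq_card => z; rewrite !inE /s'.
  by case: (eqVneq z t) => //= ->; rewrite t_u ![_ == v]eq_sym;
    rewrite (negbTE vw) (negbTE vu).
split=> [z z'|z|v v_cr|v v_sp|v].
- have [->|zt] := eqVneq z t; have [->|zt'] := eqVneq z' t => //.
  + by rewrite s't s'N // => /esym/t_free tz /esym.
  + by rewrite s't s'N // => /t_free tz /tz.
  + by rewrite !s'N //; apply: (lev_inj lev).
- rewrite moved_s' in_setU1 => /predU1P[->|mz]; first by rewrite s't t_col.
  by rewrite s'N; [apply: (lev_moved lev) | apply: contraNneq t_still => <-].
- have [->|vu] := eqVneq v u; first by rewrite load_u in u_over.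
  rewrite load_v //; first exact: (lev_crowded lev).
  by apply: contraNneq w_sparse => <-.
- have [->|vw] := eqVneq v w; first by rewrite load_w.
  rewrite load_v //; first exact: (lev_sparse lev).
  by apply: contraNneq v_sp => ->.
- rewrite /row_moves moved_s'; have [vt|vt] := eqVneq v (row t).
    apply: leq_trans t_row; rewrite vt.
    apply: leq_trans (_ : #|t |: (moved s :&: [set z | row z == row t])| <= _).
      apply/subset_leq_card/subsetP=> z; rewrite !inE.
      by case/andP=> /orP[->//|->] ->; rewrite orbT.
    by rewrite cardsU1; case: (_ \notin _).
  apply: leq_trans (lev_row lev v); apply/subset_leq_card/subsetP=> z.
  rewrite !inE => /andP[/predU1P[->|->] ]; last by move->.
  by rewrite eq_sym (negbTE vt).
Qed.

Lemma levelling_exists :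
  #|T| <= 2 * (a + b) -> #|T| < #|C| * b ->
  exists2 s, levelling s & forall u, load s u <= b.
Proof.
move=> T_card C_card.
suff extend n s : levelling s -> #|T| - #|moved s| < n ->
    exists2 s, levelling s & forall u, load s u <= b.
  exact: extend levelling_init (ltnSn _).
elim: n s => // n IHn s lev s_n.
have [/forallP ok|] := boolP [forall u, load s u <= b]; first by exists s.
rewrite negb_forall => /existsP[u]; rewrite -ltnNge => u_over.
have [s' lev' more] := levelling_step T_card C_card lev u_over.
apply: (IHn s' lev'); have le_T : #|moved s'| <= #|T| := max_card _.
by lia.
Qed.

End Levelling.

(** * Routing in the product *)

Section Product.
Variables (G H : sgraph) (I : finType).
Variables (cG : H -> G -> G -> option I) (cH : G -> H -> H -> option I).

Definition cart_colour (p q : cart_prod G H) : option I :=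
  if p.1 == q.1 then cH p.1 p.2 q.2
  else if p.2 == q.2 then cG p.2 p.1 q.1 else None.

Lemma cart_colour_sym :
  (forall v u u', cG v u u' = cG v u' u) ->
  (forall u v v', cH u v v' = cH u v' v) ->
  forall p q, cart_colour p q = cart_colour q p.
Proof.
move=> cGC cHC [u v] [u' v']; rewrite /cart_colour /= [u' == u]eq_sym.
rewrite [v' == v]eq_sym.
by case: eqVneq => [->|_] //; case: eqVneq => [->|].
Qed.

Lemma cart_connect_row i v u u' : connect (colour_rel (cG v) i) u u' ->
  connect (colour_rel cart_colour i) (u, v) (u', v).
Proof.
have lift : {homo pair^~ v : w w' /
    colour_rel (cG v) i w w' >-> colour_rel cart_colour i w w'}.
  move=> w w' /andP[ww' cw].
  rewrite /colour_rel /cart_colour /= /cart_adj /= eqxx ww' andbT orbT /=.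
  by case: (eqVneq w w') ww' => [->|//]; rewrite adj_irrefl.
case/connectP=> p up ->; apply/connectP; exists (map (pair^~ v) p).
  exact: homo_path lift up.
exact: esym (last_map (pair^~ v) p u).
Qed.

Lemma cart_connect_col i u v v' : connect (colour_rel (cH u) i) v v' ->
  connect (colour_rel cart_colour i) (u, v) (u, v').
Proof.
have lift : {homo pair u : w w' /
    colour_rel (cH u) i w w' >-> colour_rel cart_colour i w w'}.
  move=> w w' /andP[ww' cw].
  by rewrite /colour_rel /cart_colour /= /cart_adj /= eqxx ww' cw.
case/connectP=> p vp ->; apply/connectP; exists (map (pair u) p).
  exact: homo_path lift vp.
exact: esym (last_map (pair u) p v).
Qed.

End Product.

Lemma injection_avoiding (I V : finType) (B : {set V}) :
  #|I| + #|B| <= #|V| ->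
  exists2 f : I -> V, injective f & forall i, f i \notin B.
Proof.
move=> leV; have I_le : #|I| <= #|~: B| by rewrite cardsCs setCK; lia.
exists (fun i => enum_val (widen_ord I_le (enum_rank i))) => [i j|i].
  by move/enum_val_inj/(congr1 val) => /= /ord_inj/enum_rank_inj.
by have := enum_valP (widen_ord I_le (enum_rank i)); rewrite inE.
Qed.

(** The case [a <= b], in which free rows are plentiful: the terminals are
levelled into columns holding at most [b] each, and [f i] is the free row of
pair [i]. *)
Lemma cart_prod_pairable_le (a b : nat) (G H : sgraph) :
  0 < a -> a <= b ->
  path_pairable a G -> 4 < #|G| ->
  path_pairable b H -> 6 * b <= #|H| ->
  path_pairable (a + b) (cart_prod G H).
Proof.
move=> a_gt0 ab G_pp G_card H_pp H_card; split.
  by rewrite card_prod; nia.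
move=> x y injx injy xy; apply: linked_paths.
(* Terminal [(i, false)] is [x i] and terminal [(i, true)] is [y i]. *)
pose T := ('I_(a + b) * bool)%type.
pose pos (t : T) := if t.2 then y t.1 else x t.1.
pose mate (t : T) : T := (t.1, ~~ t.2).
pose col t := (pos t).1; pose row t := (pos t).2.
have cell_inj s t : col s = col t -> row s = row t -> s = t.
  move=> c r; have : pos s = pos t.
    by rewrite [pos s]surjective_pairing [pos t]surjective_pairing; congr pair.
  case: s t {c r} => i [] [j []]; rewrite /pos /=.
  - by move/injy->.
  - by move/esym/eqP; rewrite (negbTE (xy _ _)).
  - by move/eqP; rewrite (negbTE (xy _ _)).
  - by move/injx->.
have T_card : #|{: T}| = 2 * (a + b).
  by rewrite card_prod card_ord card_bool mulnC.
have [|| s lev s_load] := @levelling_exists _ _ _ col row a b cell_inj a_gt0.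
- by rewrite T_card.
- by rewrite T_card; nia.
have [|f f_inj f_free] := @injection_avoiding 'I_(a + b) H (row @: [set: T]).
  have := leq_imset_card row [set: T]; rewrite cardsT T_card card_ord => le_rows.
  by apply: leq_trans (leq_add (leqnn _) le_rows) _; lia.
have f_row i t : f i != row t.
  by apply: contraNneq (f_free i) => ->; apply: imset_f.
(* Row [v] carries the shifts of its terminals; if it is the free row of [i],
   it has no terminals and all its edges get colour [i]. *)
have rows v : exists c : G -> G -> option 'I_(a + b),
    [/\ forall u u', c u u' = c u' u,
        forall t, row t = v -> connect (colour_rel c t.1) (col t) (s t) &
        forall i u u', f i = v -> connect (colour_rel c i) u u'].
  have [i /eqP fi|none] := pickP [pred i | f i == v].
    exists (fun _ _ => Some i); split=> // [t /eqP|j u u' fj].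
      by rewrite -fi eq_sym (negbTE (f_row _ _)).
    rewrite (f_inj j i) ?fj //.
    have := path_pairable_connected u u' a_gt0 G_pp; apply: connect_sub.
    by move=> w w' ww'; apply: connect1; rewrite /colour_rel ww' eqxx.
  have [||t t'|t t'|c cC con] := @path_pairable_linked a G T
    (moved col s :&: [set t | row t == v]) col s G_pp.
  - exact: (lev_row lev).
  - move=> t t'; rewrite !inE => /andP[_ /eqP rt] /andP[_ /eqP rt'] ct.
    by apply: cell_inj; rewrite // rt rt'.
  - rewrite !inE => /andP[_ /eqP rt] /andP[_ /eqP rt'] st.
    by apply: (lev_inj lev); rewrite // rt rt'.
  - rewrite 2!in_setI => /andP[/(lev_moved lev)[ct _] _].
    case/andP=> /(lev_moved lev)[_ st'] _.
    by apply: contraNneq st' => <-.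
  (* [c] tells terminals apart; the product colours only tell pairs apart. *)
  exists (fun u u' => omap fst (c u u')); split=> [u u'|t rt|i u u' fi].
  - by rewrite cC.
  - have [->|mt] := eqVneq (s t) (col t); first exact: connect0.
    have /con : t \in (moved col s :&: [set t | row t == v]).
      by rewrite !inE mt rt /=.
    apply: connect_sub => u u' /andP[uu' /eqP cu]; apply: connect1.
    by rewrite /colour_rel uu' cu /=.
  - by have := none i; rewrite /= fi eqxx.
(* Column [u] takes a terminal to the free row of its pair, or straight to its
   mate when both are in [u]. *)
have cols u : exists c : H -> H -> option 'I_(a + b),
    [/\ forall v v', c v v' = c v' v,
        forall t, s t = u -> s (mate t) != u ->
          connect (colour_rel c t.1) (row t) (f t.1) &
        forall i, s (i, false) = u -> s (i, true) = u ->
          connect (colour_rel c i) (row (i, false)) (row (i, true))].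
  (* Of two mates in [u], only the one with label [false] is a source: the other
     one is its target. *)
  pose D := [set t | (s t == u) && ~~ (t.2 && (s (mate t) == u))].
  pose goal (t : T) := if s (mate t) == u then row (mate t) else f t.1.
  have [||t t'|t t'|c cC con] := @path_pairable_linked b H T D row goal H_pp.
  - apply: leq_trans (s_load u); apply/subset_leq_card/subsetP=> t.
    by rewrite !inE => /andP[].
  - move=> t t'; rewrite !inE => /andP[/eqP st _] /andP[/eqP st' _].
    by apply: (lev_inj lev); rewrite st st'.
  - rewrite !inE /goal => /andP[/eqP st nt] /andP[/eqP st' nt'].
    case: ifP nt => [/eqP mt|mt] nt; case: ifP nt' => [/eqP mt'|mt'] nt'.
    + move=> r; have := lev_inj lev (etrans mt (esym mt')) r.
      by case: t t' {r mt mt' st st'} nt nt' => i [] [j []] //= _ _ [->].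
    + by move/esym/eqP; rewrite (negbTE (f_row _ _)).
    + by move/eqP; rewrite (negbTE (f_row _ _)).
    + move/f_inj; case: t t' st st' mt mt' {nt nt'} => i o [j o'] /= st st' + + E.
      subst j; rewrite /mate /=; have [->//|] := eqVneq o o'.
      by case: o o' st st' => [] [] //= -> -> ; rewrite eqxx.
  - rewrite !inE /goal => /andP[/eqP st nt] /andP[/eqP st' nt'].
    case: ifP nt' => [/eqP mt'|_] nt'; last by rewrite eq_sym f_row.
    apply/eqP => r; have E := lev_inj lev (etrans st (esym mt')) r.
    case: t' E st' nt' {r mt'} => j [] //= E st' _; subst t.
    by move: nt; rewrite /mate /= st' eqxx.
  exists (fun v v' => omap fst (c v v')).
  have weaken t : t \in D ->
      connect (colour_rel (fun v v' => omap fst (c v v')) t.1) (row t) (goal t).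
    move/con; apply: connect_sub => v v' /andP[vv' /eqP cv]; apply: connect1.
    by rewrite /colour_rel vv' cv /=.
  split=> [v v'|t st mt|i si si'].
  - by rewrite cC.
  - have := weaken t; rewrite /goal inE st eqxx (negbTE mt) andbF /=.
    by apply.
  - have := weaken (i, false); rewrite /goal inE /= si /mate /= si' eqxx.
    by apply.
have [cG cGP] := fin_all_exists rows; have [cH cHP] := fin_all_exists cols.
pose c := cart_colour cG cH.
have cC : forall p q, c p q = c q p.
  by apply: cart_colour_sym => [v|u]; [have [] := cGP v|have [] := cHP u].
exists c => // i _; rewrite -[x i]/(pos (i, false)) -[y i]/(pos (i, true)).
have shift o : connect (colour_rel c i) (pos (i, o)) (s (i, o), row (i, o)).
  rewrite [pos _]surjective_pairing; apply: cart_connect_row.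
  by have [_ + _] := cGP (row (i, o)); apply.
apply: connect_trans (shift false) _; rewrite (colour_rel_sym _ cC).
apply: connect_trans (shift true) _; rewrite (colour_rel_sym _ cC).
have [E|ne] := eqVneq (s (i, false)) (s (i, true)).
  rewrite -E; apply: cart_connect_col.
  by have [_ _] := cHP (s (i, false)); apply.
have climb o : connect (colour_rel c i) (s (i, o), row (i, o)) (s (i, o), f i).
  apply: cart_connect_col; have [_ + _] := cHP (s (i, o)) => /(_ (i, o)); apply=> //.
  by case: o; rewrite /mate //= eq_sym.
apply: connect_trans (climb false) _; rewrite (colour_rel_sym _ cC).
apply: connect_trans (climb true) _; rewrite (colour_rel_sym _ cC).
by apply: cart_connect_row; have [_ _] := cGP (f i); apply.
Qed.

Lemma cart_prod_swap k (G H : sgraph) :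
  path_pairable k (cart_prod H G) -> path_pairable k (cart_prod G H).
Proof.
pose f (p : cart_prod G H) : cart_prod H G := (p.2, p.1).
pose g (p : cart_prod H G) : cart_prod G H := (p.2, p.1).
have fK : cancel f g by case.
have gK : cancel g f by case.
apply: (path_pairable_iso fK gK) => p q.
by rewrite /= /cart_adj /= orbC andbC [X in _ || X]andbC.
Qed.

Theorem theorem1 (a b : nat) (G H : sgraph)
  (a_gt0 : 0 < a) (b_gt0 : 0 < b)
  (G_pp : path_pairable a G) (G_card : 8 * a <= #|G|)
  (H_pp : path_pairable b H) (H_card : 8 * b <= #|H|) :
  path_pairable (a + b) (cart_prod G H).
Proof.
have [ab|ba] := leqP a b; first by apply: cart_prod_pairable_le => //; lia.
by rewrite addnC; apply: cart_prod_swap; apply: cart_prod_pairable_le => //; lia.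
Qed.
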